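(* Fix $\alpha>0$, $b\in(0,1)$, $m\ge1$. Let $\mathsf{X}_i,\mathsf{Y}_i\in\mathbb{Z}-i(\alpha-1)$, $i=1,\dots,m$, be such that $\mathsf{X}_i-\mathsf{X}_{i+1}\ge\alpha$ and $\mathsf{Y}_i-\mathsf{Y}_{i+1}\ge\alpha$ for $1\le i\le m-1$, and $\mathsf{Y}_i-\mathsf{X}_i\in\{-1,0\}$ for all $i$. For a positive integer $L$ set $$\mathsf{x}_i(L)=\mathsf{X}_i+i(\alpha-1)+L,\qquad \mathsf{y}_i(L)=\mathsf{Y}_i+i(\alpha-1)+L,\qquad i=1,\dots,m.$$ Then in the limit $t\to1$ (with $0<t<1$), $L\to+\infty$, $q=t^\alpha$, $t^L\to b$, the transition probabilities $\Upsilon_m(\vec{\mathsf{x}}(L),\vec{\mathsf{y}}(L))$ converge to $$b^{\,m-|\vec{\mathsf{X}}|+|\vec{\mathsf{Y}}|}(1-b)^{|\vec{\mathsf{X}}|-|\vec{\mathsf{Y}}|}\prod_{1\le i<j\le m}\frac{(\mathsf{X}_i-\alpha\,\mathbf{1}_{\mathsf{Y}_i=\mathsf{X}_i-1})-(\mathsf{X}_j-\alpha\,\mathbf{1}_{\mathsf{Y}_j=\mathsf{X}_j-1})}{\mathsf{X}_i-\mathsf{X}_j}.$$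
   Context: $\mathbb{W}_m$ is the set of integer vectors $\vec{\mathsf{x}}=(\mathsf{x}_1>\dots>\mathsf{x}_m\ge0)$; for large $L$ the vectors $\vec{\mathsf{x}}(L),\vec{\mathsf{y}}(L)$ belong to $\mathbb{W}_m$. $|\vec{\mathsf{X}}|=\sum_i\mathsf{X}_i$; $\mathbf{1}_A$ is the indicator of $A$. For $|p|<1$, $(z;p)_\infty=\prod_{i\ge 0}(1-zp^i)$, and for $0<q,t<1$ $$V_{t,q}(\vec{\mathsf{x}})=\prod_{1\le i<j\le m}\frac{\left(q^{j-i-1}t^{\mathsf{x}_i-\mathsf{x}_j-j+i+1};t\right)_\infty}{\left(q^{j-i}t^{\mathsf{x}_i-\mathsf{x}_j-j+i+1};t\right)_\infty}.$$ For $\vec{\mathsf{x}},\vec{\mathsf{y}}\in\mathbb{W}_m$ with $\mathsf{y}_i-\mathsf{x}_i\in\{-1,0\}$ for all $i$, $$\Upsilon_m(\vec{\mathsf{x}},\vec{\mathsf{y}})=t^{-\binom m2}\,\frac{V_{t,q}(\vec{\mathsf{y}})}{V_{t,q}(\vec{\mathsf{x}})}\prod_{\substack{1\le i<j\le m\\ \mathsf{y}_i=\mathsf{x}_i,\ \mathsf{y}_j=\mathsf{x}_j-1}}\frac{(1-t^{i-j+\mathsf{x}_i-\mathsf{x}_j+1}q^{j-i-1})(1-t^{i-j+\mathsf{x}_i-\mathsf{x}_j}q^{j-i+1})}{(1-t^{i-j+\mathsf{x}_i-\mathsf{x}_j+1}q^{j-i})(1-t^{i-j+\mathsf{x}_i-\mathsf{x}_j}q^{j-i})}\prod_{i:\,\mathsf{y}_i=\mathsf{x}_i}t^{\mathsf{x}_i}\prod_{i:\,\mathsf{y}_i=\mathsf{x}_i-1}\left(t^{m-i}-q^{m-i}t^{\mathsf{x}_i}\right).$$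 *)

(* Defs.v *)
From mathcomp Require Import all_boot all_order all_algebra.
From mathcomp Require Import all_classical all_reals all_analysis.

Set Implicit Arguments.
Unset Strict Implicit.
Unset Printing Implicit Defensive.

Import Order.TTheory GRing.Theory Num.Theory.
Import numFieldNormedType.Exports.

Local Open Scope classical_set_scope.
Local Open Scope ring_scope.

(* The infinite product (z; p)_oo. It converges for `|p| < 1; outside that
   range the value of limn is meaningless. *)
Definition qpoch (R : realType) (z p : R) : R :=
  limn (fun n : nat => \prod_(i < n) (1 - z * p ^+ i)).

(* Vectors are functions on 'I_m = {0, ..., m-1}, so the coordinate with
   1-based index i is the one at i - 1. Differences of indices are unaffected,
   while an index occurring on its own becomes i.+1. *)

Definition V (R : realType) (t q : R) (m : nat) (x : 'I_m -> int) : R :=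
  \prod_(i < m) \prod_(j < m | (i < j)%N)
    (qpoch (q ^ (j%:Z - i%:Z - 1) * t ^ (x i - x j - j%:Z + i%:Z + 1)) t
     / qpoch (q ^ (j%:Z - i%:Z) * t ^ (x i - x j - j%:Z + i%:Z + 1)) t).

(* Only meaningful for 0 < t, q < 1, x and y strictly decreasing with
   nonnegative entries, and y i - x i equal to -1 or 0 for all i. *)
Definition Upsilon (R : realType) (t q : R) (m : nat) (x y : 'I_m -> int) : R :=
  t ^- 'C(m, 2) * (V t q y / V t q x)
  * (\prod_(i < m) \prod_(j < m | [&& (i < j)%N, y i == x i & y j == x j - 1])
      (((1 - t ^ (i%:Z - j%:Z + x i - x j + 1) * q ^ (j%:Z - i%:Z - 1))
        * (1 - t ^ (i%:Z - j%:Z + x i - x j) * q ^ (j%:Z - i%:Z + 1)))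
       / ((1 - t ^ (i%:Z - j%:Z + x i - x j + 1) * q ^ (j%:Z - i%:Z))
          * (1 - t ^ (i%:Z - j%:Z + x i - x j) * q ^ (j%:Z - i%:Z)))))
  * (\prod_(i < m | y i == x i) t ^ x i)
  * (\prod_(i < m | y i == x i - 1)
      (t ^+ (m - i.+1) - q ^+ (m - i.+1) * t ^ x i)).

(* Main.v *)
Require Import Defs.
From mathcomp Require Import all_boot all_order all_algebra.
From mathcomp Require Import all_classical all_reals all_analysis.
From mathcomp Require Import ring lra.

Set Implicit Arguments.
Unset Strict Implicit.
Unset Printing Implicit Defensive.

Import Order.TTheory GRing.Theory Num.Theory.
Import numFieldNormedType.Exports.

Local Open Scope classical_set_scope.
Local Open Scope ring_scope.

(** Once [q = t^alpha], the exponents in [V] and [Upsilon] involve the integer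
coordinates only through the gaps [D = X_i - X_j]: the shift [i (alpha - 1)]
absorbs both the powers of [q] and the index differences, and [L] cancels. The
pair [(i, j)] contributes [(t^(D - alpha + 1); t)_oo / (t^(D + 1); t)_oo] to [V]
(lemma [VE]).

When [x] moves to [y], a gap changes by [0], [1] or [-1], so the relation
[(z; p)_oo = (1 - z) (zp; p)_oo] leaves only finitely many factors of
[V(y) / V(x)]. Combined with the explicit rational factor of [Upsilon], every
pair contributes exactly [(1 - t^(D')) / (1 - t^D)], where [D'] is the gap after
[alpha] has been subtracted from each [X_i] whose particle moves (lemma
[pair_factor]). Hence, for each fixed [t] in [(0, 1)], [Upsilon] is a finite
product with no infinite product left (lemma [UpsilonE]). The cancellation
needs the remaining infinite products to be nonzero (lemma [qpoch_gt0]), which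
is where the gap conditions on [X] and on [Y] enter.

The limit is then taken factor by factor: [(1 - t^a) / (1 - t^c)] tends to
[a / c] as [t] increases to [1] (lemma [cvg_1BpowR_ratio]); each particle that
stays contributes [t^(x_i)], which tends to [b]; each particle that moves
contributes a factor tending to [1 - b]. Since [Y_i = X_i - 1] for the moving
particles and [Y_i = X_i] for the others, [|X| - |Y|] counts the moving ones. *)

(** * Infinite q-Pochhammer products *)

Lemma prod_1B_ge_1Bsum (R : numDomainType) (a : nat -> R) (n : nat) :
  (forall i, 0 <= a i <= 1) ->
  1 - \sum_(i < n) a i <= \prod_(i < n) (1 - a i).
Proof.
move=> a01; elim: n => [|n IHn]; first by rewrite !big_ord0 subr0.
rewrite !big_ord_recr /=; have /andP[an0 an1] := a01 n.
have s0 : 0 <= \sum_(i < n) a i.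
  by apply: sumr_ge0 => i _; have /andP[] := a01 i.
apply: (@le_trans _ _ ((1 - \sum_(i < n) a i) * (1 - a n))); last first.
  by rewrite ler_wpM2r ?subr_ge0.
rewrite -subr_ge0.
have -> : (1 - \sum_(i < n) a i) * (1 - a n) - (1 - (\sum_(i < n) a i + a n))
  = (\sum_(i < n) a i) * a n by ring.
exact: mulr_ge0.
Qed.

Lemma is_cvg_qpoch (R : realType) (z p : R) :
  0 <= z < 1 -> 0 <= p < 1 ->
  cvgn (fun n : nat => \prod_(i < n) (1 - z * p ^+ i)).
Proof.
move=> /andP[z0 z1] /andP[p0 p1].
have zp i : 0 <= z * p ^+ i <= 1.
  rewrite mulr_ge0 ?exprn_ge0 //=.
  by apply: mulr_ile1; rewrite ?exprn_ge0 ?(ltW z1) // exprn_ile1 // ltW.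
have prod0 n : 0 <= \prod_(i < n) (1 - z * p ^+ i).
  by apply: prodr_ge0 => i _; rewrite subr_ge0; have /andP[] := zp i.
apply: nonincreasing_is_cvgn; last by exists 0 => _ [n _ <-].
apply/nonincreasing_seqP => n; rewrite big_ord_recr /=.
apply: ler_piMr; first exact: prod0.
by rewrite lerBlDr lerDl; have /andP[] := zp n.
Qed.

Lemma qpochE (R : realType) (z p : R) : 0 <= z < 1 -> 0 <= p < 1 ->
  qpoch z p = (1 - z) * qpoch (z * p) p.
Proof.
move=> z01 p01; have /andP[z0 z1] := z01; have /andP[p0 p1] := p01.
have zp01 : 0 <= z * p < 1.
  by rewrite mulr_ge0 //= (le_lt_trans _ z1) // ler_piMr // ltW.
apply: cvg_lim => //; rewrite -cvg_shiftS.
rewrite (_ : (fun _ => _) =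
  fun n => (1 - z) * \prod_(i < n) (1 - z * p * p ^+ i)); last first.
  apply/funext => n; rewrite big_ord_recl expr0 mulr1; congr (_ * _).
  by apply: eq_bigr => i _; rewrite -mulrA -exprS.
by apply: cvgMl_tmp; exact: is_cvg_qpoch.
Qed.

(** A convergent product of positive factors may vanish. If [z < 1 - p], the
bound [prod (1 - a_i) >= 1 - sum a_i] and the geometric series give
[qpoch z p >= 1 - z / (1 - p) > 0]; in general, peeling off finitely many
positive factors by [qpochE] replaces [z] by [z p^N], which is that small. *)
Lemma qpoch_gt0 (R : realType) (z p : R) : 0 <= z < 1 -> 0 <= p < 1 ->
  0 < qpoch z p.
Proof.
move=> z01 p01; have /andP[p0 p1] := p01.
have small w : 0 <= w -> w < 1 - p -> 0 < qpoch w p.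
  move=> w0 wp; have w01 : 0 <= w < 1 by rewrite w0; lra.
  apply: (@lt_le_trans _ _ (1 - w / (1 - p))).
    by rewrite subr_gt0 ltr_pdivrMr ?mul1r ?subr_gt0.
  apply: limr_ge; first exact: is_cvg_qpoch.
  near=> n; apply: le_trans (@prod_1B_ge_1Bsum R (fun i => w * p ^+ i) n _); last first.
    move=> i; rewrite mulr_ge0 ?exprn_ge0 //=.
    have /andP[_ /ltW w1] := w01.
    by apply: mulr_ile1; rewrite ?exprn_ge0 // exprn_ile1 // ltW.
  rewrite lerD2l lerN2 -mulr_sumr ler_wpM2l //.
  rewrite -[leRHS]mul1r ler_pdivlMr ?subr_gt0 // -lerN2 -mulrN opprB mulrC.
  by rewrite -subrX1 lerBrDl subrr exprn_ge0.
have /cvgrPdist_lt /(_ (1 - p)) : (GRing.exp p : R^nat) n @[n --> \oo] --> (0:R).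
  by apply: cvg_expr; rewrite ger0_norm.
rewrite subr_gt0 => /(_ p1) [N _ /(_ N (leqnn N))] /=.
rewrite sub0r normrN ger0_norm ?exprn_ge0 // => pN.
have {}pN : z * p ^+ N < 1 - p.
  have /andP[z0 /ltW z1] := z01.
  by apply: le_lt_trans pN; rewrite ler_piMl ?exprn_ge0.
elim: N z z01 pN => [|N IHN] z z01 pN; have /andP[z0 z1] := z01.
  by apply: small => //; rewrite -[z]mulr1.
rewrite qpochE // mulr_gt0 ?subr_gt0 //; apply: IHN; last by rewrite -mulrA -exprS.
by rewrite mulr_ge0 //= (le_lt_trans _ z1) // ler_piMr // ltW.
Unshelve. all: by end_near. Qed.

(** * The contribution of one pair of particles *)

Lemma powR_lt1 (R : realType) (t a : R) : 0 < t < 1 -> 0 < a -> 0 <= t `^ a < 1.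
Proof.
move=> /andP[t0 t1] a0; rewrite powR_ge0 /= /powR gt_eqF // -expR0 ltr_expR.
by rewrite pmulr_rlt0 // ln_lt0 ?t0.
Qed.

(** The [(i, j)] factor of [V] when [q = t^alpha] and [D = X_i - X_j]. *)
Definition gap_weight (R : realType) (t alpha D : R) : R :=
  qpoch (t `^ (D - alpha + 1)) t / qpoch (t `^ (D + 1)) t.

Lemma gap_weight_neq0 (R : realType) (t alpha D : R) :
  0 < t < 1 -> 0 < alpha -> alpha <= D -> gap_weight t alpha D != 0.
Proof.
move=> t01 a0 aD; have /andP[/ltW t0 t1] := t01.
by rewrite mulf_neq0 ?invr_neq0 // gt_eqF // qpoch_gt0 ?t0 //;
   apply: powR_lt1 => //; lra.
Qed.

Lemma gap_weightD1 (R : realType) (t alpha D : R) :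
  0 < t < 1 -> 0 < alpha -> alpha <= D ->
  gap_weight t alpha (D + 1) / gap_weight t alpha D =
  (1 - t `^ (D + 1)) / (1 - t `^ (D - alpha + 1)).
Proof.
move=> t01 a0 aD; have /andP[t0 t1] := t01.
have t01' : 0 <= t < 1 by rewrite ltW.
have step a : 0 < a -> qpoch (t `^ a) t = (1 - t `^ a) * qpoch (t `^ (a + 1)) t.
  move=> ap; rewrite qpochE //; last exact: powR_lt1.
  by rewrite powRD ?powRr1 ?(ltW t0) // (gt_eqF t0) implybT.
have pos a : 0 < a -> qpoch (t `^ a) t != 0 /\ 1 - t `^ a != 0.
  move=> ap; have /(_ t01 ap) h := @powR_lt1 R t a.
  split; first by rewrite gt_eqF // qpoch_gt0.
  by rewrite gt_eqF // subr_gt0; case/andP: h.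
have h1 : 0 < D - alpha + 1 by lra.
have h2 : 0 < D + 1 by lra.
rewrite /gap_weight (step _ h1) (step _ h2).
have -> : D + 1 - alpha + 1 = D - alpha + 1 + 1 by ring.
have [_ n1] := pos _ h1; have [_ n2] := pos _ h2.
have [n3 _] : qpoch (t `^ (D - alpha + 1 + 1)) t != 0 /\ 1 - t `^ (D - alpha + 1 + 1) != 0.
  by apply: pos; lra.
have [n4 _] : qpoch (t `^ (D + 1 + 1)) t != 0 /\ 1 - t `^ (D + 1 + 1) != 0.
  by apply: pos; lra.
by field; rewrite n1 n2 n3 n4.
Qed.

(** [ei] and [ej] tell which particle of the pair moves. If both or neither do,
the gap is unchanged and both sides are [1]. If only the [i]-th one moves, the
ratio of weights alone gives the result. If only the [j]-th one moves, the ratio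
of weights has spurious factors [1 - t^(D + 1)] and [1 - t^(D - alpha + 1)],
which the rational factor of [Upsilon] cancels. *)
Lemma pair_factor (R : realType) (t alpha D : R) (ei ej : bool) :
  0 < t < 1 -> 0 < alpha -> alpha <= D -> alpha <= D - ei%:R + ej%:R ->
  gap_weight t alpha (D - ei%:R + ej%:R) / gap_weight t alpha D *
  (if ~~ ei && ej then
     ((1 - t `^ (D - alpha + 1)) * (1 - t `^ (D + alpha))) /
     ((1 - t `^ (D + 1)) * (1 - t `^ D)) else 1) =
  (1 - t `^ (D - alpha * ei%:R + alpha * ej%:R)) / (1 - t `^ D).
Proof.
move=> t01 a0 aD.
have pos a : 0 < a -> 1 - t `^ a != 0.
  move=> ap; rewrite gt_eqF // subr_gt0.
  by have /andP[] := powR_lt1 t01 ap.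
have nD : 1 - t `^ D != 0 by apply: pos; lra.
have w0 := gap_weight_neq0 t01 a0 aD.
case: ei ej => [] [] /= aD'; rewrite ?mulr1 ?mulr0 ?subr0 ?addr0 ?subrK ?divff //.
- (* [gap_weightD1] at the gap [D - 1], inverted *)
  have -> : D = (D - 1) + 1 by ring.
  rewrite addr0 in aD'.
  rewrite -[LHS]invrK invf_div addrK gap_weightD1 // invf_div.
  by rewrite !subrK; congr ((1 - _ `^ _) / _); ring.
- rewrite gap_weightD1 //.
  have n1 : 1 - t `^ (D + 1) != 0 by apply: pos; lra.
  have n2 : 1 - t `^ (D - alpha + 1) != 0 by apply: pos; lra.
  by field; rewrite nD n1 n2.
Qed.

(** * Limits as t increases to 1 *)

Lemma cvg_powR_at1 (R : realType) (a : R) : t `^ a @[t --> 1^'-] --> (1 : R).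
Proof.
apply: cvg_at_left_filter; have {2}<- : 1 `^ a = 1 :> R by rewrite powR1.
have d : derivable (fun t : R => t `^ a) 1 1.
  by apply: ex_derive; exact: is_derive1_powR.
by move/derivable1_diffP/differentiable_continuous : d; exact.
Qed.

(** L'Hopital's rule: the ratio of the derivatives is
[a t^(a - 1) / (c t^(c - 1))]. *)
Lemma cvg_1BpowR_ratio (R : realType) (a c : R) : c != 0 ->
  (1 - t `^ a) / (1 - t `^ c) @[t --> 1^'-] --> a / c.
Proof.
move=> c0.
have d (k x : R) : x \in `]0, 1[ ->
    is_derive x 1 (fun t : R => 1 - t `^ k) (- (k * x `^ (k - 1))).
  rewrite in_itv /= => /andP[x0 _].
  rewrite -[X in is_derive _ _ _ X]add0r; apply: is_deriveB.
  exact: is_derive1_powR.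
have l0 (k : R) : 1 - t `^ k @[t --> 1^'-] --> (0 : R).
  by rewrite -[0](subrr 1); apply: cvgB; [exact: cvg_cst|exact: cvg_powR_at1].
apply: (@lhopital_at_left R _ _ _ _ 0 1 _ ltr01 (d a) (d c)) => //.
  move=> x; rewrite in_itv /= => /andP[x0 _].
  by rewrite oppr_eq0 mulf_neq0 // gt_eqF // powR_gt0.
under eq_fun do rewrite invrN mulrNN.
have -> : a / c = (a * 1) / (c * 1) by rewrite !mulr1.
have l1 (k : R) : k * t `^ (k - 1) @[t --> 1^'-] --> k * 1.
  by apply: cvgMl_tmp; exact: cvg_powR_at1.
by apply: cvgM; [exact: l1 | apply: cvgV; [rewrite mulr1 | exact: l1]].
Qed.

(** * Upsilon as a finite product when q is a power of t *)

Lemma intexp_powR (R : realType) (t a : R) (z w : int) : 0 < t ->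
  (t `^ a) ^ z * t ^ w = t `^ (a * z%:~R + w%:~R).
Proof.
move=> t0; rewrite -(powR_intmul _ (powR_ge0 _ _)) -(powR_intmul _ (ltW t0)).
by rewrite -powRrM -powRD // (gt_eqF t0) implybT.
Qed.

(** The exponent [alpha (j - i)] coming from [q^(j - i)] compensates the
difference [(i - j) (alpha - 1)] of the shifts and the term [i - j], so only
[X_i - X_j] remains; the common shift [c] cancels. *)
Lemma VE (R : realType) (t alpha c : R) (m : nat) (x : 'I_m -> int)
    (X : 'I_m -> R) :
  0 < t -> (forall i, (x i)%:~R = X i + i.+1%:R * (alpha - 1) + c) ->
  V t (t `^ alpha) x =
  \prod_(i < m) \prod_(j < m | (i < j)%N) gap_weight t alpha (X i - X j).
Proof.
move=> t0 xE; apply: eq_bigr => i _; apply: eq_bigr => j _.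
rewrite /gap_weight; congr (qpoch _ _ / qpoch _ _); rewrite intexp_powR //;
  congr (_ `^ _); rewrite !(intrD, mulrNz) !xE -!pmulrn; ring.
Qed.

(** The predicate [e] selects the particles that move; the natural number [c]
plays the role of [L]. *)
Lemma UpsilonE (R : realType) (t alpha : R) (c : nat) (m : nat)
    (x y : 'I_m -> int) (X : 'I_m -> R) (e : pred 'I_m) :
  0 < t < 1 -> 0 < alpha ->
  (forall i, (x i)%:~R = X i + i.+1%:R * (alpha - 1) + c%:R) ->
  (forall i, y i = x i - (e i)%:Z) ->
  (forall i j : 'I_m, (i < j)%N -> alpha <= X i - X j) ->
  (forall i j : 'I_m, (i < j)%N ->
     alpha <= (X i - (e i)%:R) - (X j - (e j)%:R)) ->
  Upsilon t (t `^ alpha) x y =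
  t ^- 'C(m, 2)
  * (\prod_(i < m) \prod_(j < m | (i < j)%N)
      ((1 - t `^ ((X i - alpha * (e i)%:R) - (X j - alpha * (e j)%:R)))
       / (1 - t `^ (X i - X j))))
  * (\prod_(i < m | ~~ e i) (t `^ (X i + i.+1%:R * (alpha - 1)) * t ^+ c))
  * (\prod_(i < m | e i)
      (t ^+ (m - i.+1) - t `^ (alpha * (m - i.+1)%:R)
                         * (t `^ (X i + i.+1%:R * (alpha - 1)) * t ^+ c))).
Proof.
move=> t01 a0 xE yE gX gY; have /andP[t0 t1] := t01.
have ySx i : (y i == x i) = ~~ e i.
  by rewrite yE; case: (e i); rewrite ?subr0 ?eqxx // -subr_eq0 addrC addKr.
have yPx i : (y i == x i - 1) = e i.
  rewrite yE; case: (e i); rewrite ?eqxx // subr0 -subr_eq0 opprB addrC subrK.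
  by [].
have txE i : t ^ x i = t `^ (X i + i.+1%:R * (alpha - 1)) * t ^+ c.
  rewrite -(powR_intmul _ (ltW t0)) xE powRD ?(gt_eqF t0) ?implybT //.
  by rewrite powR_mulrn // ltW.
rewrite /Upsilon; congr (_ * _ * _); last 2 first.
- by apply: eq_big => [i|i _]; rewrite ?ySx ?txE.
- apply: eq_big => [i|i _]; rewrite ?yPx ?txE //.
  by rewrite -(powR_mulrn _ (powR_ge0 t alpha)) -powRrM.
rewrite -mulrA; congr (_ * _).
rewrite (@VE R t alpha c%:R m x X) //.
rewrite (@VE R t alpha c%:R m y (fun i => X i - (e i)%:R)) //; last first.
  by move=> i; rewrite yE intrD mulrNz xE -pmulrn; ring.
rewrite -prodf_div -big_split /=; apply: eq_bigr => i _.
rewrite -prodf_div.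
under [X in _ * X]eq_bigl => j do rewrite ySx yPx.
rewrite big_mkcondr -big_split /=; apply: eq_bigr => j ij.
have := @pair_factor R t alpha (X i - X j) (e i) (e j) t01 a0 (gX _ _ ij).
have -> : X i - X j - (e i)%:R + (e j)%:R = X i - (e i)%:R - (X j - (e j)%:R) by ring.
have -> : X i - X j - alpha * (e i)%:R + alpha * (e j)%:R =
  X i - alpha * (e i)%:R - (X j - alpha * (e j)%:R) by ring.
move=> /(_ (gY _ _ ij)) <-; congr (_ * _); case: ifP => // _.
rewrite ![t ^ _ * _]mulrC !intexp_powR //.
by congr (((1 - _ `^ _) * (1 - _ `^ _)) / ((1 - _ `^ _) * (1 - _ `^ _)));
  rewrite !(intrD, mulrNz) !xE -!pmulrn; ring.
Qed.

(** * The limit transition probabilities *)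

Lemma gap_trans (R : numDomainType) (a : R) (m : nat) (X : 'I_m -> R) :
  0 <= a -> (forall i j : 'I_m, j = i.+1 :> nat -> a <= X i - X j) ->
  forall i j : 'I_m, (i < j)%N -> a <= X i - X j.
Proof.
move=> a0 gX i j /subnKC; move: (j - i.+1)%N => k.
elim: k j => [|k IHk] j jE; first by apply: gX; rewrite -jE addn0.
have km : (i.+1 + k < m)%N by rewrite (leq_trans _ (ltn_ord j)) // -jE addnS.
have jk : j = (Ordinal km).+1 :> nat by rewrite -jE /= addnS.
have := lerD (IHk (Ordinal km) erefl) (gX _ _ jk).
by rewrite addrA subrK; apply: le_trans; rewrite lerDl.
Qed.

(* The limit regime is expressed along an arbitrary filter F on an index type
   T; sequences are the case T = nat, F = \oo. *)
Theorem proposition4p2 (R : realType) (alpha b : R) (m : nat)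
    (halpha : 0 < alpha) (hb0 : 0 < b) (hb1 : b < 1) (hm : (1 <= m)%N)
    (X Y : 'I_m -> R)
    (hX : forall i : 'I_m, X i + i.+1%:R * (alpha - 1) \is a Num.int)
    (hY : forall i : 'I_m, Y i + i.+1%:R * (alpha - 1) \is a Num.int)
    (hXgap : forall i j : 'I_m, j = i.+1 :> nat -> alpha <= X i - X j)
    (hYgap : forall i j : 'I_m, j = i.+1 :> nat -> alpha <= Y i - Y j)
    (hXY : forall i : 'I_m, Y i - X i = -1 \/ Y i - X i = 0)
    (x y : nat -> 'I_m -> int)
    (hx : forall (L : nat) (i : 'I_m), (0 < L)%N ->
       (x L i)%:~R = X i + i.+1%:R * (alpha - 1) + L%:R)
    (hy : forall (L : nat) (i : 'I_m), (0 < L)%N ->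
       (y L i)%:~R = Y i + i.+1%:R * (alpha - 1) + L%:R)
    (T : Type) (F : set_system T) (FF : Filter F) (t : T -> R) (L : T -> nat)
    (ht : t u @[u --> F] --> (1 : R)^'-)
    (hL : L u @[u --> F] --> \oo)
    (htL : t u ^+ L u @[u --> F] --> b) :
  Upsilon (t u) (t u `^ alpha) (x (L u)) (y (L u)) @[u --> F] -->
    b `^ (m%:R - (\sum_(i < m) X i) + (\sum_(i < m) Y i))
    * (1 - b) `^ ((\sum_(i < m) X i) - (\sum_(i < m) Y i))
    * \prod_(i < m) \prod_(j < m | (i < j)%N)
        (((X i - alpha * (Y i == X i - 1)%:R)
          - (X j - alpha * (Y j == X j - 1)%:R)) / (X i - X j)).
Proof.
(* the particles that move *)
pose e i := Y i == X i - 1.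
have YE i : Y i = X i - (e i)%:R.
  rewrite /e; case: eqP => [//|YX1]; case: (hXY i) => YX.
    by case: YX1; lra.
  by rewrite subr0; lra.
have gX := gap_trans (ltW halpha) hXgap.
have gY := gap_trans (ltW halpha) hYgap.
have xK n i : (0 < n)%N -> y n i = x n i - (e i)%:Z.
  move=> n0; apply: (@intr_inj R).
  by rewrite intrD mulrNz (hx n i n0) (hy n i n0) YE -pmulrn; ring.
have cpow a : t u `^ a @[u --> F] --> (1 : R).
  exact: cvg_comp _ _ ht (@cvg_powR_at1 R a).
have cexp n : t u ^+ n @[u --> F] --> (1 : R).
  have ct : t u @[u --> F] --> (1 : R).
    by apply: (cvg_trans ht); exact: cvg_within.
  have := cvg_comp _ _ ct (@exprn_continuous _ n (1 : R)).
  by rewrite expr1n.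
have cx i : t u `^ (X i + i.+1%:R * (alpha - 1)) * t u ^+ L u @[u --> F] --> b.
  by rewrite -[X in _ --> X]mul1r; apply: cvgM.
have cprod (P : pred 'I_m) (f : 'I_m -> T -> R) (l : 'I_m -> R) :
    (forall i, P i -> f i u @[u --> F] --> l i) ->
    \prod_(i < m | P i) f i u @[u --> F] --> \prod_(i < m | P i) l i.
  by apply: cvg_big; exact: mul_continuous.
have -> : b `^ (m%:R - \sum_(i < m) X i + \sum_(i < m) Y i) =
    \prod_(i < m | ~~ e i) b.
  rewrite prodr_const -powR_mulrn ?(ltW hb0) //; congr (_ `^ _).
  rewrite -sumr_const.
  under [X in _ + X]eq_bigr do rewrite YE.
  rewrite sumrB addrA addrNK -[m in m%:R]card_ord -sumr_const -sumrB.
  rewrite [RHS]big_mkcond; apply: eq_bigr => i _.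
  by rewrite unfold_in; case: (e i); rewrite /= ?subrr ?subr0.
have -> : (1 - b) `^ (\sum_(i < m) X i - \sum_(i < m) Y i) =
    \prod_(i < m | e i) (1 - b).
  rewrite prodr_const -powR_mulrn ?subr_ge0 ?(ltW hb1) //; congr (_ `^ _).
  rewrite -sumr_const -sumrB [RHS]big_mkcond; apply: eq_bigr => i _.
  by rewrite YE subKr -[i \in _]/(e i); case: (e i).
(* The factor [1] inserted here is the limit of [t^-C(m, 2)]. *)
rewrite mulrC mulrA -[X in X * _ * _]mul1r -[X in X * _ * _ * _](@invr1 R).
have t01 : \forall u \near F, 0 < t u < 1.
  have h0 := ht _ (nbhs_left_gt ltr01); have h1 := ht _ (nbhs_left_lt 1).
  by near=> u; apply/andP; split; near: u; [exact: h0|exact: h1].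
have L0 := hL _ (nbhs_infty_gt 0).
apply: cvg_trans (near_eq_cvg _) _.
  near=> u; apply/esym/(@UpsilonE R (t u) alpha (L u) m _ _ X e) => //.
  - by near: u.
  - by move=> i; apply: hx; near: u.
  - by move=> i; apply: xK; near: u.
  - by move=> i j ij; rewrite -!YE gY.
apply: cvgM; first apply: cvgM; first apply: cvgM.
- by apply: cvgV => //; exact: oner_neq0.
- apply: (cprod xpredT) => i _; apply: cprod => j ij.
  have D0 : X i - X j != 0 by rewrite gt_eqF // (lt_le_trans halpha) // gX.
  exact: (cvg_comp _ _ ht (@cvg_1BpowR_ratio R
    ((X i - alpha * (e i)%:R) - (X j - alpha * (e j)%:R)) _ D0)).
- exact: cprod.
- apply: cprod => i _; apply: cvgB; first exact: cexp.
  by rewrite -[X in _ --> X]mul1r; apply: cvgM.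
Unshelve. all: by end_near. Qed.
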